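(* Let $m\in\mathbb{N}$ and, for $i=1,\dots,m$, let $f_i,g_i:[0,\infty)^m\to[0,\infty)$ be Lipschitz continuous functions. Let $\Delta t>0$ and $u_i^0\ge 0$ for $i=1,\dots,m$. Then a numerical solution $\boldsymbol{u}^k=(u_1^k,\dots,u_m^k)$, $k\in\mathbb{N}$, to the difference equations \[ \frac{u_i^{k+1}-u_i^k}{\Delta t}=-f_i(\boldsymbol{u}^k)\,u_i^{k+1}+g_i(\boldsymbol{u}^k),\qquad k\in\mathbb{N}\cup\{0\},\quad i=1,\dots,m, \] with initial value $\boldsymbol{u}^0=(u_1^0,\dots,u_m^0)$ exists and satisfies $u_i^k\ge 0$ for all $k\in\mathbb{N}$ and all $i=1,\dots,m$.
   Context: A numerical solution is a sequence $(\boldsymbol{u}^k)_{k\ge0}$ of vectors satisfying the difference equations for every $k\ge 0$, with the prescribed $\boldsymbol{u}^0$. The step size $\Delta t>0$ is arbitrary. *)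

(* Defs.v *)
From HB Require Import structures.
From mathcomp Require Import all_boot all_order all_algebra.
From mathcomp Require Import all_classical all_reals all_analysis.
Import Order.TTheory GRing.Theory Num.Theory.
Import numFieldNormedType.Exports.

Set Implicit Arguments.
Unset Strict Implicit.
Unset Printing Implicit Defensive.

Local Open Scope classical_set_scope.
Local Open Scope ring_scope.

Definition nonneg_orthant (R : realType) (m : nat) : set 'rV[R]_m :=
  [set x | forall i : 'I_m, 0 <= x ord0 i].

Arguments nonneg_orthant : clear implicits.

(* The norm on 'rV[R]_m is the sup norm; as all norms on R^m are equivalent,
   the choice of norm does not affect which functions are Lipschitz.
   A function on the orthant is encoded as a total function constrained on the
   orthant only; its values elsewhere are arbitrary. *)
Definition nonneg_lipschitz (R : realType) (m : nat) (h : 'rV[R]_m -> R) : Prop :=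
  (forall x, nonneg_orthant R m x -> 0 <= h x) /\
  [lipschitz h x | x in nonneg_orthant R m].

(* The iterates are deliberately not required to lie in the orthant, so that
   nonnegativity of a numerical solution is not built into the definition. *)
Definition numerical_solution (R : realType) (m : nat)
    (f g : 'I_m -> 'rV[R]_m -> R) (dt : R) (u0 : 'rV[R]_m)
    (u : nat -> 'rV[R]_m) : Prop :=
  u 0%N = u0 /\
  forall (k : nat) (i : 'I_m),
    (u k.+1 ord0 i - u k ord0 i) / dt
      = - f i (u k) * u k.+1 ord0 i + g i (u k).

(* Main.v *)
(* The scheme is linear in u_i^{k+1}: it amounts to
   u_i^{k+1} = (u_i^k + dt g_i(u^k)) / (1 + dt f_i(u^k)), and as long as u^k lies
   in the orthant the denominator is positive and the numerator nonnegative. *)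
Require Import Defs.
From HB Require Import structures.
From mathcomp Require Import all_boot all_order all_algebra.
From mathcomp Require Import all_classical all_reals all_analysis.
From mathcomp Require Import ring lra.
Import Order.TTheory GRing.Theory Num.Theory.
Import numFieldNormedType.Exports.
Local Open Scope classical_set_scope.
Local Open Scope ring_scope.

(** As [dt] is positive and [1 + dt * a] is at least 1, clearing both denominators is reversible.
    Left to right computes the next iterate of a given solution; right to left verifies the
    constructed one. *)
Lemma implicit_stepP {F : realFieldType} {dt a b x y : F} :
  0 < dt -> 0 <= a ->
  (y - x) / dt = - a * y + b <-> y = (x + dt * b) / (1 + dt * a).
Proof.
move=> dt0 a0.
have dtN0 : dt != 0 by rewrite gt_eqF.
have dN0 : 1 + dt * a != 0 by rewrite gt_eqF// ltr_wpDr// mulr_ge0// ltW.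
split=> [/(canRL (divfK dtN0)) e|->]; last by field; rewrite dN0 dtN0.
by apply: (canRL (mulfK dN0)); lra.
Qed.

(** Off the orthant the denominator may vanish and the quotient is then 0 by convention; the
    iteration below never leaves the orthant. *)
Definition explicit_step {R : realType} {m : nat}
    (f g : 'I_m -> 'rV[R]_m -> R) (dt : R) (x : 'rV[R]_m) : 'rV[R]_m :=
  \row_i ((x ord0 i + dt * g i x) / (1 + dt * f i x)).

Lemma explicit_step_ge0 {R : realType} {m : nat}
    {f g : 'I_m -> 'rV[R]_m -> R} {dt : R} {x : 'rV[R]_m} :
  (forall i x, nonneg_orthant R m x -> 0 <= f i x) ->
  (forall i x, nonneg_orthant R m x -> 0 <= g i x) ->
  0 < dt -> nonneg_orthant R m x ->
  nonneg_orthant R m (explicit_step f g dt x).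
Proof.
move=> f0 g0 dt0 x0 i; rewrite mxE.
by rewrite divr_ge0// addr_ge0 ?mulr_ge0 ?f0 ?g0// ltW.
Qed.

(** By induction on [k]. Nonnegativity of [u k] serves twice: it gives [0 <= f i (u k)], so the
    equation can be solved for the next iterate, and then it makes that iterate nonnegative. *)
Lemma numerical_solution_ge0 {R : realType} {m : nat}
    {f g : 'I_m -> 'rV[R]_m -> R} {dt : R} {u0 : 'rV[R]_m}
    {u : nat -> 'rV[R]_m} :
  (forall i x, nonneg_orthant R m x -> 0 <= f i x) ->
  (forall i x, nonneg_orthant R m x -> 0 <= g i x) ->
  0 < dt -> nonneg_orthant R m u0 -> numerical_solution f g dt u0 u ->
  forall k, nonneg_orthant R m (u k).
Proof.
move=> f0 g0 dt0 u00 [uE uS]; elim=> [|k uk0 i]; first by rewrite uE.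
have /implicit_stepP -> := uS k i; rewrite ?f0//.
by have := explicit_step_ge0 f0 g0 dt0 uk0 i; rewrite mxE.
Qed.

Theorem theorem2 (R : realType) (m : nat) (hm : (0 < m)%N)
    (f g : 'I_m -> 'rV[R]_m -> R)
    (hf : forall i, nonneg_lipschitz (f i))
    (hg : forall i, nonneg_lipschitz (g i))
    (dt : R) (hdt : 0 < dt)
    (u0 : 'rV[R]_m) (hu0 : forall i, 0 <= u0 ord0 i) :
  (exists u : nat -> 'rV[R]_m, numerical_solution f g dt u0 u) /\
  (forall u : nat -> 'rV[R]_m, numerical_solution f g dt u0 u ->
    forall (k : nat) (i : 'I_m), 0 <= u k ord0 i).
Proof.
have f0 i : forall x, nonneg_orthant R m x -> 0 <= f i x by case: (hf i).
have g0 i : forall x, nonneg_orthant R m x -> 0 <= g i x by case: (hg i).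
split; last by move=> u; exact: numerical_solution_ge0.
pose u k := iter k (explicit_step f g dt) u0.
(* Needed before the equations can be checked: [implicit_stepP] asks for [0 <= f i (u k)], known
   only on the orthant. *)
have u_ge0 k : nonneg_orthant R m (u k).
  by elim: k => // k; exact: explicit_step_ge0.
exists u; split=> // k i; apply/implicit_stepP => //; first exact: f0.
by rewrite /u iterS mxE.
Qed.
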